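(* Let $(X,d)$ be a proper, uniquely geodesic, geodesically complete metric space such that geodesics do not split, and assume that the unique midpoint map $m$ of $(X,d)$ is convex. Let $I$ be a surjective isometry of $(\mathcal{C}(X,d),d_H)$ onto itself. Then there exists an isometry $i$ of $(X,d)$ onto itself such that $I(C)=i(C)$ for all $C\in\mathcal{C}(X,d)$.
   Context: A metric space is proper if all its closed metric balls are compact. A geodesic of $(X,d)$ is an isometric embedding of an interval of $\mathbb{R}$ (with the metric $|\cdot|$) into $(X,d)$; a geodesic $\gamma:[a,b]\to X$ connects $\gamma(a)$ to $\gamma(b)$. $(X,d)$ is geodesic if any two points $x,y\in X$ are connected by a geodesic $\gamma_{xy}$, and uniquely geodesic if moreover this geodesic is unique (up to parametrization). A geodesic metric space is geodesically complete if for each geodesic $\gamma_{xy}$ connecting $x$ to $y$ there is a biinfinite extension, i.e. a geodesic $\gamma:(-\infty,\infty)\to X$ with $\mathrm{im}\,\gamma_{xy}\subset \mathrm{im}\,\gamma$. Geodesics do not split if for each geodesic $\gamma_{xy}$ with $x\neq y$ the image of this biinfinite extension is unique. In a uniquely geodesic space, the midpoint map $m:X\times X\to X$ assigns to $(x,y)$ the unique point $m(x,y)$ with $d(m(x,y),x)=\frac12 d(x,y)=d(m(x,y),y)$. It is convex if $d(m(x_1,y_1),m(x_2,y_2))\le \frac12[d(x_1,x_2)+d(y_1,y_2)]$ for all $x_1,x_2,y_1,y_2\in X$. A subset $C\subset X$ is convex if with any two points $a,b\in C$ it contains the images of all geodesics connecting $a$ to $b$. $\mathcal{C}(X,d)$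 denotes the set of nonempty convex compact subsets of $(X,d)$. For $A\subset X$ and $r\ge 0$, $N_r(A)=\{x\in X\mid \exists a\in A: d(a,x)\le r\}$, and the Hausdorff metric is $d_H(A,B)=\inf\{r\mid A\subset N_r(B)\text{ and }B\subset N_r(A)\}$. *)

(* Defs.v *)
From mathcomp Require Import all_boot all_order all_algebra.
From mathcomp Require Import boolp classical_sets functions reals.
From mathcomp Require Import topology.

Set Implicit Arguments.
Unset Strict Implicit.
Unset Printing Implicit Defensive.

Import Order.TTheory GRing.Theory Num.Theory.

Local Open Scope classical_set_scope.
Local Open Scope ring_scope.

Section MetricGeometry.
Context {R : realType} {X : metricType R}.

(* A map defined on an interval J of R is represented by a total function
   R -> X; its values outside J are irrelevant to every definition below. *)
Definition geodesic (J : interval R) (g : R -> X) : Prop :=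
  {in J &, forall s t : R, mdist (g s) (g t) = `|s - t|}.

(* The degenerate case a = b (a constant geodesic) is allowed. *)
Definition connects (a b : R) (g : R -> X) (x y : X) : Prop :=
  [/\ a <= b, geodesic `[a, b] g, g a = x & g b = y].

Definition biinfinite_extension (a b : R) (g h : R -> X) : Prop :=
  geodesic `]-oo, +oo[ h /\ g @` [set` `[a, b]] `<=` range h.

Definition same_up_to_parametrization
    (a b : R) (g : R -> X) (a' b' : R) (g' : R -> X) : Prop :=
  exists phi : R -> R,
    set_bij [set` `[a', b']] [set` `[a, b]] phi /\
    {in `[a', b'], forall t, g' t = g (phi t)}.

Definition is_midpoint (x y p : X) : Prop :=
  mdist p x = 2^-1 * mdist x y /\ mdist p y = 2^-1 * mdist x y.

(* In a uniquely geodesic space exactly one point satisfies is_midpoint x y,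
   so the default value x is never used there. *)
Definition midpoint (x y : X) : X := xget x [set p | is_midpoint x y p].

Definition convex_subset (C : set X) : Prop :=
  forall (x y : X) (a b : R) (g : R -> X),
    C x -> C y -> connects a b g x y -> g @` [set` `[a, b]] `<=` C.

Definition closed_neighborhood (r : R) (A : set X) : set X :=
  [set x | exists2 a, A a & mdist a x <= r].

Definition hausdorff_dist (A B : set X) : R :=
  inf [set r | [/\ 0 <= r, A `<=` closed_neighborhood r B
                 & B `<=` closed_neighborhood r A]].

End MetricGeometry.

Section Spaces.
Context {R : realType} (X : metricType R).

(* The library's closed_ball is the closure of the open ball, which in a
   general metric space may be smaller than the closed metric ball. *)
Definition proper_space : Prop :=
  forall (x : X) (r : R), compact [set y : X | mdist x y <= r].

Definition geodesic_space : Prop :=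
  forall x y : X, exists a b g, connects a b g x y.

Definition uniquely_geodesic : Prop :=
  geodesic_space /\
  forall (x y : X) a b g a' b' g',
    connects a b g x y -> connects a' b' g' x y ->
    same_up_to_parametrization a b g a' b' g'.

Definition geodesically_complete : Prop :=
  geodesic_space /\
  forall (x y : X) a b g, connects a b g x y ->
    exists h, biinfinite_extension a b g h.

Definition geodesics_do_not_split : Prop :=
  forall (x y : X) a b g, x <> y -> connects a b g x y ->
    forall h h', biinfinite_extension a b g h ->
      biinfinite_extension a b g h' -> range h = range h'.

Definition midpoint_convex : Prop :=
  forall x1 x2 y1 y2 : X,
    mdist (midpoint x1 y1) (midpoint x2 y2)
      <= 2^-1 * (mdist x1 x2 + mdist y1 y2).

Definition convex_compacts : set (set X) :=
  [set C | [/\ C !=set0, convex_subset C & compact C]].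

End Spaces.

Arguments convex_compacts {R} X _.

Definition isometry_onto (K T : Type) (d : T -> T -> K) (f : T -> T) : Prop :=
  (forall x y, d (f x) (f y) = d x y) /\ (forall y, exists x, f x = y).

(* The Hausdorff metric on C(X), viewed as the subtype of its members. *)
Definition hausdorff_metric (R : realType) (X : metricType R)
    (A B : set_type (convex_compacts X)) : R :=
  hausdorff_dist (sval A) (sval B).

(* Main.v *)
Require Import Defs.
From mathcomp Require Import all_boot all_order all_algebra.
From mathcomp Require Import boolp classical_sets functions reals.
From mathcomp Require Import topology normedtype derive.
From mathcomp Require Import lra.

(** Write [dH] for the Hausdorff distance.  The argument has three parts, each
resting on a metric characterization that a surjective isometry [I] of the
convex compact sets has to respect.

Points.  A set [C] is a single point iff no ball of [dH]-radius [r > 0] around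
[C] contains four sets with mutual distances at least [2 r].  Around [{x}],
two such sets lie in the ball of radius [r] about [x], so one of them has an
element [a] for which the other consists of antipodes of [a]; as geodesics do
not split, [a] has only one antipode at distance [r] behind [x], and the other
set is a singleton.  Among four sets three would then be singletons, and two of
them the antipode of the third ([point_not_spread]).  If [C] is not a point,
let [c] be a circumcenter and [r > 0] the circumradius.  Minimality of the
radius gives, for any ray from [c], an element of [C] at distance [r] from [c]
that no point of the ray approaches ([circumcenter_opposite]).  Doubling three
such radii yields the four sets: [{c}], two segments of length [2 r] issuing
from [c], and the [r]-neighborhood of [C] ([not_point_spread]).  Hence [I]
permutes the singletons and induces a surjective isometry [i] of [X].

Balls.  The number [dH {x} C] is the largest distance from [x] to [C].  Thus
[I] maps the ball [B(x, r)] into [B(i x, r)].  A sphere point [p] of the source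
is the unique point of [B(x, r)] farthest from a point [z] chosen behind [x],
and the same uniqueness on the image side forces [i p] into the image;
convexity fills in the rest ([isometry_cball]).

Membership.  A point [p] lies in [C] iff [dH C (B(p, r)) <= r] for some [r]:
if [p] is outside [C] with nearest point [q], the ray from [q] through [p]
leaves [C] at unit speed, so the point of it at distance [r] behind [p] lies
in [B(p, r)] and is farther than [r] from [C] ([mem_cball_hausdorff]).  As [I]
preserves [dH] and carries [B(p, r)] to [B(i p, r)], [p] lies in [C] iff [i p]
lies in [I C].

The geometry used throughout is that any two points lie on a biinfinite
geodesic, that betweenness determines a point by its distance to one end, and
that the distance between two affinely parametrized geodesics is a convex
function ([line_convex]). *)

Set Implicit Arguments.
Unset Strict Implicit.
Unset Printing Implicit Defensive.

Import Order.TTheory GRing.Theory Num.Theory numFieldNormedType.Exports.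

Local Open Scope classical_set_scope.
Local Open Scope ring_scope.

(** * Extremal distances to compact sets, and the Hausdorff distance *)

Section CompactSets.
Context {R : realType} {X : metricType R}.
Local Notation d := (@mdist R X).
Implicit Types (A B : set X) (x y : X) (f : X -> R).

Lemma lipschitz1_continuous f :
  (forall x y, f x <= f y + d x y) -> continuous f.
Proof.
move=> fL x; apply/cvgrPdist_lt => e e0.
apply/metricType_numDomainType.nbhs_mdistP; exists e => //= y xy.
have := fL x y; have := fL y x; rewrite (metric_sym y x).
by rewrite ltr_norml /= in xy *; lra.
Qed.

Lemma lipschitz1_max f A :
    (forall x y, f x <= f y + d x y) -> A !=set0 -> compact A ->
  exists2 a, A a & forall b, A b -> f b <= f a.
Proof.
move=> fL A0 cA.
have cf : {within A, continuous f}.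
  exact/continuous_subspaceT/lipschitz1_continuous.
have [a /set_mem Aa aM] := compact_EVT_max A0 cA cf.
by exists a => // b /mem_set; exact: aM.
Qed.

Lemma lipschitz1_min f A :
    (forall x y, f x <= f y + d x y) -> A !=set0 -> compact A ->
  exists2 a, A a & forall b, A b -> f a <= f b.
Proof.
move=> fL A0 cA.
have [x y||//|a Aa aM] := @lipschitz1_max (fun x => - f x) A.
- by have := fL y x; rewrite (metric_sym y x); lra.
- by [].
- by exists a => // b Ab; have := aM b Ab; lra.
Qed.

Lemma nearest_point x A : A !=set0 -> compact A ->
  exists2 a, A a & forall b, A b -> d x a <= d x b.
Proof.
by apply: lipschitz1_min => y z; have := metric_triangle x z y;
  rewrite (metric_sym z y).
Qed.

Lemma farthest_point x A : A !=set0 -> compact A ->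
  exists2 a, A a & forall b, A b -> d x b <= d x a.
Proof.
by apply: lipschitz1_max => y z; have := metric_triangle x z y;
  rewrite (metric_sym z y).
Qed.

(** The one-sided Hausdorff distance is a maximum of a minimum: the distance to
[B] is 1-Lipschitz, so it attains its maximum on [A]. *)
Lemma excess_attained A B : A !=set0 -> compact A -> B !=set0 -> compact B ->
  exists a b, [/\ A a, B b, forall b', B b' -> d a b <= d a b'
    & forall a', A a' -> exists2 b', B b' & d a' b' <= d a b].
Proof.
move=> A0 cA B0 cB.
have near x : {b | B b & forall b', B b' -> d x b <= d x b'}.
  by apply: cid2; exact: nearest_point.
pose p x := s2val (near x).
have Bp x : B (p x) by exact: (s2valP (near x)).
have pmin x b : B b -> d x (p x) <= d x b by exact: (s2valP' (near x)).
have [x y||//|a Aa aM] := @lipschitz1_max (fun x => d x (p x)) A.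
- rewrite (le_trans (pmin x _ (Bp y)))// addrC.
  exact: metric_triangle.
- by [].
- exists a, (p a); split => // [b'|a' Aa']; first exact: pmin.
  by exists (p a') => //; exact: aM.
Qed.

(** The infimum defining the Hausdorff distance is attained, because nearest
points exist. *)
Lemma hausdorff_leP A B r : A !=set0 -> compact A -> B !=set0 -> compact B ->
  hausdorff_dist A B <= r <->
  [/\ 0 <= r, A `<=` closed_neighborhood r B & B `<=` closed_neighborhood r A].
Proof.
move=> A0 cA B0 cB; rewrite /hausdorff_dist; set S := [set _ | _].
have Slb : has_lbound S by exists 0 => s [].
have [a [b [Aa Bb _ ABle]]] := excess_attained A0 cA B0 cB.
have [b' [a' [Bb' Aa' _ BAle]]] := excess_attained B0 cB A0 cA.
have S0 : S !=set0.
  exists (d a b + d b' a'); split; first by rewrite addr_ge0 // mdist_ge0.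
    move=> x Ax; have [y By xy] := ABle x Ax; exists y => //.
    by rewrite metric_sym (le_trans xy) // lerDl mdist_ge0.
  move=> y By; have [x Ax yx] := BAle y By; exists x => //.
  by rewrite metric_sym (le_trans yx) // lerDr mdist_ge0.
split => [Sr|]; last exact: ge_inf.
have lt_S e : 0 < e -> exists2 s, S s & s < r + e.
  move=> e0; have [s Ss sr] := inf_adherent e0 (conj S0 Slb).
  by exists s => //; rewrite (lt_le_trans sr) // lerD2r.
split.
- by rewrite (le_trans _ Sr) // lb_le_inf // => s [].
- move=> x Ax; have [y By ymin] := nearest_point x B0 cB; exists y => //.
  rewrite metric_sym; apply/ler_addgt0Pl => e e0; rewrite addrC.
  have [s [_ /(_ x Ax)[z Bz zx] _] sr] := lt_S e e0.
  by rewrite (le_trans (ymin z Bz)) // metric_sym (le_trans zx) // ltW.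
- move=> y By; have [x Ax xmin] := nearest_point y A0 cA; exists x => //.
  rewrite metric_sym; apply/ler_addgt0Pl => e e0; rewrite addrC.
  have [s [_ _ /(_ y By)[z Az zy]] sr] := lt_S e e0.
  by rewrite (le_trans (xmin z Az)) // metric_sym (le_trans zy) // ltW.
Qed.

Lemma hausdorff_geP A B r : A !=set0 -> compact A -> B !=set0 -> compact B ->
    0 < r -> r <= hausdorff_dist A B ->
  (exists2 a, A a & forall b, B b -> r <= d a b) \/
  (exists2 b, B b & forall a, A a -> r <= d b a).
Proof.
move=> A0 cA B0 cB r0 rH; rewrite -implyNp => AB.
have [a [b [Aa Bb ab ABle]]] := excess_attained A0 cA B0 cB.
have [b' [a' [Bb' Aa' ba BAle]]] := excess_attained B0 cB A0 cA.
exists b' => // x Ax; apply: le_trans (ba x Ax).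
rewrite leNgt; apply/negP => ltr.
have ltr' : d a b < r.
  rewrite ltNge; apply/negP => rab; apply: AB; exists a => // y By.
  exact: le_trans rab (ab y By).
have : hausdorff_dist A B <= Num.max (d a b) (d b' a').
  apply/hausdorff_leP => //; split; first by rewrite le_max mdist_ge0.
    move=> z Az; have [y By zy] := ABle z Az; exists y => //.
    by rewrite metric_sym le_max zy.
  move=> y By; have [z Az zy] := BAle y By; exists z => //.
  by rewrite metric_sym le_max zy orbT.
by rewrite leNgt (lt_le_trans _ rH) // gt_max ltr' ltr.
Qed.

Lemma hausdorff_ge A B r a : A !=set0 -> compact A -> B !=set0 -> compact B ->
  A a -> (forall b, B b -> r <= d a b) -> r <= hausdorff_dist A B.
Proof.
move=> A0 cA B0 cB Aa rB.
have /(hausdorff_leP _ A0 cA B0 cB)[_ AB _] := lexx (hausdorff_dist A B).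
by have [b Bb ba] := AB a Aa; rewrite (le_trans (rB b Bb)) // metric_sym.
Qed.

Lemma hausdorff_sym A B : hausdorff_dist A B = hausdorff_dist B A.
Proof.
by rewrite /hausdorff_dist; congr inf; apply/seteqP; split => r [].
Qed.

End CompactSets.
(** * Geodesic lines *)

(** Subtracting the chord gives a midpoint convex [g], bounded above and vanishing
at 0 and 1; each [u] in [[0, 1]] is the midpoint
of an endpoint and another point of the interval, so [g u <= sup g / 2], and
[sup g <= 0]. *)
Lemma midpoint_convex_le (R : realType) (f : R -> R) (M : R) :
    (forall u, 0 <= u <= 1 -> f u <= M) ->
    (forall u v, 0 <= u <= 1 -> 0 <= v <= 1 ->
       f (2^-1 * (u + v)) <= 2^-1 * (f u + f v)) ->
  forall u, 0 <= u <= 1 -> f u <= (1 - u) * f 0 + u * f 1.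
Proof.
move=> fM fmid.
pose g u := f u - ((1 - u) * f 0 + u * f 1).
pose S := [set g u | u in [set u | 0 <= u <= 1]].
have g_le u : 0 <= u <= 1 -> g u <= sup S.
  move=> u01; apply: ub_le_sup; last by exists u.
  exists (M + `|f 0| + `|f 1|) => _ [v v01 <-]; rewrite /g.
  have := fM v v01; have := ler_norm (- f 0); have := ler_norm (- f 1).
  rewrite !normrN; have := normr_ge0 (f 0); have := normr_ge0 (f 1).
  by case/andP: v01 => *; nra.
have gmid u v : 0 <= u <= 1 -> 0 <= v <= 1 ->
    g (2^-1 * (u + v)) <= 2^-1 * (g u + g v).
  by move=> u01 v01; have := fmid u v u01 v01; rewrite /g; lra.
have g0 : g 0 = 0 by rewrite /g; lra.
have g1 : g 1 = 0 by rewrite /g; lra.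
have half u : 0 <= u <= 1 -> g u <= 2^-1 * sup S.
  move=> u01; have [u2|u2] := leP u 2^-1.
    have -> : u = 2^-1 * (0 + 2 * u) by lra.
    have := gmid 0 (2 * u); have := g_le (2 * u).
    by rewrite g0; case/andP: u01 => *; lra.
  have -> : u = 2^-1 * ((2 * u - 1) + 1) by lra.
  have := gmid (2 * u - 1) 1; have := g_le (2 * u - 1).
  by rewrite g1; case/andP: u01 => *; lra.
have S_le : sup S <= 2^-1 * sup S.
  apply: ge_sup => [|_ [u u01 <-]]; last exact: half.
  by exists (g 0), 0 => //=; lra.
by move=> u u01; have := g_le u u01; rewrite /g; lra.
Qed.

Section Lines.
Context {R : realType} {X : metricType R}.
Local Notation d := (@mdist R X).
Implicit Types (x y z p q : X) (h k : R -> X) (A B : set X) (r s t : R).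

Definition line h := forall s t, d (h s) (h t) = `|s - t|.

Lemma line_geodesic h : line h <-> geodesic `]-oo, +oo[ h.
Proof.
by split=> [lh s t _ _|gh s t]; [exact: lh|apply: gh; rewrite in_itv].
Qed.

Lemma line_le h s t : line h -> s <= t -> d (h s) (h t) = t - s.
Proof. by move=> lh st; rewrite lh distrC ger0_norm // subr_ge0. Qed.

Lemma line_shift h a : line h -> line (fun t => h (t + a)).
Proof. by move=> lh s t; rewrite lh; congr `|_|; lra. Qed.

Lemma line_opp h : line h -> line (fun t => h (- t)).
Proof. by move=> lh s t; rewrite lh distrC; congr `|_|; lra. Qed.

Context (Xuniq : uniquely_geodesic X)
  (Xcomplete : geodesically_complete X).

Lemma line_through x y : exists h, [/\ line h, h 0 = x & h (d x y) = y].
Proof.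
have [Xgeo extX] := Xcomplete.
have [a [b [g gxy]]] := Xgeo x y.
have [h [/line_geodesic lh gh]] := extX _ _ _ _ _ gxy.
have [ab _ ga gb] := gxy.
have [s _ hs] : range h x.
  by apply: gh; exists a => //=; rewrite in_itv /= lexx ab.
have [t _ ht] : range h y.
  by apply: gh; exists b => //=; rewrite in_itv /= ab lexx.
have [st|/ltW ts] := leP s t.
  exists (fun u => h (u + s)); split; [exact: line_shift|by rewrite add0r|].
  by rewrite -hs -ht line_le // subrK.
exists (fun u => h (- (u - s))); split.
- by have := line_shift (- s) (line_opp lh).
- by rewrite add0r opprK.
- rewrite -hs -ht metric_sym line_le //; congr h; lra.
Qed.

(** Equality in the triangle inequality makes the concatenation of a geodesic
from [x] to [p] with one from [p] to [y] a geodesic. *)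
Lemma broken_geodesic x p y : d x p + d p y = d x y ->
  exists2 g, connects 0 (d x y) g x y & g (d x p) = p.
Proof.
move=> xpy; have [h [lh h0 h1]] := line_through x p.
have [k [lk k0 k1]] := line_through p y.
have xp0 := mdist_ge0 x p; have py0 := mdist_ge0 p y.
pose g u := if u <= d x p then h u else k (u - d x p).
have gle u v : 0 <= u -> u <= v -> v <= d x y -> d (g u) (g v) = v - u.
  move=> u0 uv vD; rewrite /g; case: leP => [up|pu].
    case: leP => vp; first exact: line_le.
    have hup : d (h u) p = d x p - u by rewrite -{1}h1 line_le.
    have xhu : d x (h u) = u by rewrite -{1}h0 line_le // subr0.
    have pkv : d p (k (v - d x p)) = v - d x p by rewrite -{1}k0 line_le //; lra.
    have kvy : d (k (v - d x p)) y = d x y - v by rewrite -[X in d _ X]k1 line_le //; lra.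
    have := metric_triangle (h u) p (k (v - d x p)).
    have := metric_triangle x (h u) y.
    have := metric_triangle (h u) (k (v - d x p)) y.
    lra.
  by rewrite ifF ?line_le //; lra.
exists g; last by rewrite /g lexx.
split; [exact: mdist_ge0| |by rewrite /g xp0|].
  move=> s t; rewrite !in_itv /= => /andP[s0 sD] /andP[t0 tD].
  have [st|/ltW ts] := leP s t; first by rewrite gle // distrC ger0_norm // subr_ge0.
  by rewrite metric_sym gle // ger0_norm // subr_ge0.
rewrite /g; case: leP => [Dp|pD]; last by rewrite -xpy addrC addKr.
have py : p = y by apply: mdist_positivity; lra.
by rewrite -py in Dp *; rewrite h1.
Qed.

(** Two geodesics from [x] to [y], one through each point, agree up to a
reparametrization, which preserves the distance to [x] and hence is trivial. *)
Lemma between_unique x y p q :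
  d x p + d p y = d x y -> d x q + d q y = d x y -> d x p = d x q -> p = q.
Proof.
move=> xpy xqy pq; have [g gxy gp] := broken_geodesic xpy.
have [g' gxy' gq] := broken_geodesic xqy.
have [phi [[phiin _ _] g'E]] := Xuniq.2 _ _ _ _ _ _ _ _ gxy gxy'.
have [D0 Gg g0 _] := gxy; have [_ Gg' g'0 g'D] := gxy'.
have q_in : d x q \in `[0, d x y].
  by rewrite in_itv /= mdist_ge0 /=; have := mdist_ge0 q y; lra.
have := phiin (d x q); rewrite /= => /(_ q_in) phi_in.
have qE : q = g (phi (d x q)) by rewrite -g'E // gq.
have /andP[phi0 _] : 0 <= phi (d x q) <= d x y by rewrite in_itv in phi_in.
have xq : d x q = phi (d x q).
  rewrite {1}qE -{1}g0 Gg // ?in_itv /= ?lexx //.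
  by rewrite sub0r normrN ger0_norm.
by rewrite qE -xq -pq gp.
Qed.

Lemma between_line h s t p : line h -> s <= t ->
  d (h s) p + d p (h t) = t - s -> p = h (s + d (h s) p).
Proof.
move=> lh st spt; have sp0 := mdist_ge0 (h s) p; have pt0 := mdist_ge0 p (h t).
apply: (@between_unique (h s) (h t)).
- by rewrite line_le.
- by rewrite !line_le //; lra.
- by rewrite line_le //; lra.
Qed.

Lemma connects_line a b g x y : connects a b g x y ->
  exists2 h, line h & {in `[a, b], g =1 h}.
Proof.
case=> ab Gg ga gb; have [h [lh h0 hD]] := line_through x y.
have a_in : a \in `[a, b] by rewrite in_itv /= lexx.
have b_in : b \in `[a, b] by rewrite in_itv /= lexx andbT.
have xy : d x y = b - a by rewrite -ga -gb Gg // distrC ger0_norm // subr_ge0.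
exists (fun t => h (t + - a)) => [|t t_in]; first exact: line_shift.
have /andP[at_ tb] : a <= t <= b by rewrite in_itv in t_in.
have xt : d x (g t) = t - a.
  by rewrite -ga Gg // distrC ger0_norm // subr_ge0.
have ty : d (g t) y = b - t.
  by rewrite -gb Gg // distrC ger0_norm // subr_ge0.
have : d (h 0) (g t) + d (g t) (h (d x y)) = d x y - 0 by rewrite h0 hD xt ty; lra.
by move/(between_line lh (mdist_ge0 _ _)); rewrite h0 xt add0r.
Qed.

(** Every geodesic segment is part of a line, which frees convexity from the
parameter intervals of the segments. *)
Lemma convex_lineP (C : set X) : convex_subset C <->
  forall h s u t, line h -> s <= u <= t -> C (h s) -> C (h t) -> C (h u).
Proof.
split=> [cC h s u t lh /andP[su ut] Cs Ct|cC x y a b g Cx Cy gxy _ [u u_in <-]].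
  apply: (cC _ _ s t h Cs Ct); last by exists u => //=; rewrite in_itv /= su ut.
  by split=> //; exact: le_trans su ut.
have [h lh gh] := connects_line gxy; have [ab _ ga gb] := gxy.
have a_in : a \in `[a, b] by rewrite in_itv /= lexx.
have b_in : b \in `[a, b] by rewrite in_itv /= lexx andbT.
have aub : a <= u <= b by move: u_in; rewrite /= in_itv.
rewrite gh //; apply: (cC h a u b lh aub).
  by rewrite -gh // ga.
by rewrite -gh // gb.
Qed.

Lemma midpoint_line h s t : line h -> midpoint (h s) (h t) = h (2^-1 * (s + t)).
Proof.
move=> lh; rewrite /midpoint.
have hm : is_midpoint (h s) (h t) (h (2^-1 * (s + t))).
  rewrite /is_midpoint !lh; have [st|ts] := leP s t.
    by rewrite ger0_norm ?ler0_norm ?ler0_norm; lra.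
  by rewrite ler0_norm ?ger0_norm ?ger0_norm; lra.
pose M := [set p | is_midpoint (h s) (h t) p].
have [] : M (xget (h s) M) by apply: xgetPex; exists (h (2^-1 * (s + t))).
set p := xget _ _; rewrite metric_sym => mx my.
have [] := hm; rewrite metric_sym => hx hy.
apply: (@between_unique (h s) (h t)); lra.
Qed.

Context (Xnosplit : geodesics_do_not_split X).

(** Both prolongations of the geodesic from [x] to [y] lie on lines; these have
the same range since geodesics do not split, and a point of a line is
determined by its distances to two of its points. *)
Lemma extension_unique x y z z' : x <> y ->
    d x y + d y z = d x z -> d x y + d y z' = d x z' -> d y z = d y z' ->
  z = z'.
Proof.
move=> xNy xyz xyz' zz'.
have xy0 : 0 < d x y by rewrite mdist_gt0; apply/eqP.
have yz0 := mdist_ge0 y z.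
have [h [lh h0 hz]] := line_through x z.
have [h' [lh' h'0 hz']] := line_through x z'.
have on k w : line k -> k 0 = x -> k (d x w) = w -> d x y + d y w = d x w ->
    k (d x y) = y.
  move=> lk k0 kw xyw; apply/esym.
  have := @between_line k 0 (d x w) y lk (mdist_ge0 _ _).
  by rewrite k0 kw xyw subr0 add0r; exact.
have hy := on _ _ lh h0 hz xyz; have hy' := on _ _ lh' h'0 hz' xyz'.
have hh' u : 0 <= u <= d x y -> h u = h' u.
  move=> /andP[u0 uy]; have := @between_line h' 0 (d x y) (h u) lh' (ltW xy0).
  have xhu : d x (h u) = u by rewrite -{1}h0 line_le // subr0.
  have huy : d (h u) y = d x y - u by rewrite -[X in d _ X]hy line_le.
  by rewrite h'0 hy' xhu huy add0r; apply; lra.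
have hxy : connects 0 (d x y) h x y by split => //; exact: ltW.
have eh : biinfinite_extension 0 (d x y) h h.
  by split; [exact/line_geodesic|move=> _ [u _ <-]; exists u].
have eh' : biinfinite_extension 0 (d x y) h h'.
  split; first exact/line_geodesic.
  by move=> _ [u u_in <-]; exists u => //; rewrite hh'.
have [u _ uz'] : range h z'.
  by rewrite (Xnosplit xNy hxy eh eh'); exists (d x z').
rewrite -hz -uz'; congr h.
have := lh u 0; have := lh u (d x y); rewrite h0 hy uz' subr0.
rewrite (metric_sym z' x) (metric_sym z' y).
have := ler_norm (d x y - u); rewrite distrC.
by have [u0|u0] := leP 0 u; [rewrite (ger0_norm u0)|rewrite (ltr0_norm u0)]; lra.
Qed.

Context (Xmid : midpoint_convex X) (Xproper : proper_space X).

(** Midpoint convexity says that the distance between the affine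
parametrizations [u |-> h (a + u b)] and [u |-> k (a' + u b')] is midpoint
convex; a constant parametrization ([b' = 0]) gives the distance to a point. *)
Lemma line_convex h k a b a' b' u : line h -> line k -> 0 <= u <= 1 ->
  d (h (a + u * b)) (k (a' + u * b'))
    <= (1 - u) * d (h a) (k a') + u * d (h (a + b)) (k (a' + b')).
Proof.
move=> lh lk u01.
pose f v := d (h (a + v * b)) (k (a' + v * b')).
have f0 : f 0 = d (h a) (k a') by rewrite /f !mul0r !addr0.
have f1 : f 1 = d (h (a + b)) (k (a' + b')) by rewrite /f !mul1r.
rewrite -f0 -f1 -/(f u).
pose M := `|b| + d (h a) (k a') + `|b'|.
apply: (@midpoint_convex_le R f M) => // [v /andP[v0 v1]|v w _ _].
  have hv : d (h (a + v * b)) (h a) = v * `|b|.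
    by rewrite lh addrAC subrr add0r normrM ger0_norm.
  have kv : d (k a') (k (a' + v * b')) = v * `|b'|.
    by rewrite metric_sym lk addrAC subrr add0r normrM ger0_norm.
  have := metric_triangle (h (a + v * b)) (h a) (k (a' + v * b')).
  have := metric_triangle (h a) (k a') (k (a' + v * b')).
  by rewrite /f /M; have := normr_ge0 b; have := normr_ge0 b'; nra.
have := Xmid (h (a + v * b)) (k (a' + v * b')) (h (a + w * b)) (k (a' + w * b')).
rewrite !midpoint_line // /f.
by congr (d (h _) (k _) <= _); lra.
Qed.

(** * Convex compact sets *)

Definition cball x r : set X := [set y | d x y <= r].

Lemma cball_neighborhood x r : cball x r = closed_neighborhood r [set x].
Proof.
by apply/seteqP; split => [y xy|y [_ ->]] //; exists x.
Qed.

(** Let [a], [b] in [A] be close to the ends of a segment.  The point at the same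
proportion [v] on the segment from [a] to [b] is close by [line_convex]. *)
Lemma neighborhood_convex A r :
  convex_subset A -> convex_subset (closed_neighborhood r A).
Proof.
move=> /convex_lineP cA; apply/convex_lineP => h s u t lh /andP[su ut].
move=> [a Aa as_] [b Ab bt].
have [st|ts] := ltP s t; last by exists a => //; have -> : u = s by lra.
have [k [lk k0 kb]] := line_through a b.
have ts0 : 0 < t - s by rewrite subr_gt0.
pose v := (u - s) / (t - s).
have v0 : 0 <= v by rewrite divr_ge0 // subr_ge0 // ltW.
have v1 : v <= 1 by rewrite ler_pdivrMr // mul1r lerD2r.
have uE : u = s + v * (t - s) by rewrite divfK ?gt_eqF //; lra.
exists (k (0 + v * d a b)).
  apply: (cA k 0 _ (d a b)) => //; last 2 first.
  - by rewrite k0.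
  - by rewrite kb.
  by have := mdist_ge0 a b; nra.
have := @line_convex h k s (t - s) 0 (d a b) v lh lk.
have -> : s + (t - s) = t by lra.
rewrite -uE v0 v1 k0 !add0r kb metric_sym => /(_ isT).
rewrite metric_sym in as_; rewrite metric_sym in bt.
nra.
Qed.

Lemma neighborhood_compact A r :
  A !=set0 -> compact A -> compact (closed_neighborhood r A).
Proof.
move=> A0 cA.
have near x : {b | A b & forall b', A b' -> d x b <= d x b'}.
  by apply: cid2; exact: nearest_point.
pose f x := d x (s2val (near x)).
have fmin x b : A b -> f x <= d x b by exact: (s2valP' (near x)).
have cf : continuous f.
  apply: lipschitz1_continuous => x y.
  rewrite (le_trans (fmin x _ (s2valP (near y)))) // addrC.
  exact: metric_triangle.
have fE : closed_neighborhood r A = f @^-1` [set s | s <= r].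
  apply/seteqP; split => [x [a Aa ax]|x fx].
    by rewrite /= (le_trans (fmin x a Aa)) // metric_sym.
  by exists (s2val (near x)); [exact: (s2valP (near x))|rewrite metric_sym].
have [a0 Aa0] := A0.
have [a1 _ a1max] := farthest_point a0 A0 cA.
apply: (@subclosed_compact _ _ (cball a0 (d a0 a1 + r))).
- by rewrite fE; apply: closed_comp => [x _|]; [exact: cf|exact: closed_le].
- exact: Xproper.
- move=> x [a Aa ax]; rewrite /cball /=.
  by rewrite (le_trans (metric_triangle _ a _)) // lerD // a1max.
Qed.

Lemma set1_convex_compact x : convex_compacts X [set x].
Proof.
split; [by exists x| |exact: compact_set1].
apply/convex_lineP => h s u t lh /andP[su ut] /= hs ht.
have st := line_le lh (le_trans su ut); rewrite hs ht mdistxx in st.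
by rewrite -hs; congr h; lra.
Qed.

Lemma neighborhood_convex_compact A r : 0 <= r -> convex_compacts X A ->
  convex_compacts X (closed_neighborhood r A).
Proof.
move=> r0 [[a Aa] vA cA]; split.
- by exists a, a => //; rewrite mdistxx.
- exact: neighborhood_convex.
- by apply: neighborhood_compact => //; exists a.
Qed.

Lemma cball_convex_compact x r : 0 <= r -> convex_compacts X (cball x r).
Proof.
move=> r0; rewrite cball_neighborhood.
exact/neighborhood_convex_compact/set1_convex_compact.
Qed.

Lemma line_continuous h : line h -> continuous h.
Proof.
move=> lh s; apply/metricType_numDomainType.cvgrPdist_lt => e e0.
near=> t; rewrite lh; near: t.
by apply: (cvgrPdist_lt _ _).1 e e0; exact: cvg_id.
Unshelve. all: by end_near. Qed.

Definition arc h r : set X := h @` [set` `[0, r]].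

Lemma arc_convex_compact h r : line h -> 0 <= r -> convex_compacts X (arc h r).
Proof.
move=> lh r0; split.
- by exists (h 0), 0 => //=; rewrite in_itv /= lexx.
- apply/convex_lineP => k s u t lk /andP[su ut].
  move=> [p + hp] [q + hq]; rewrite /= !in_itv /= => /andP[p0 pr] /andP[q0 qr].
  have st := line_le lk (le_trans su ut).
  have sku := line_le lk su; have ukt := line_le lk ut.
  have [pq|/ltW qp] := leP p q.
    exists (p + d (h p) (k u)).
      rewrite /= in_itv /= hp sku; rewrite -hp -hq line_le // in st.
      by apply/andP; split; lra.
    apply/esym/(@between_line h p q) => //.
    by rewrite hp hq sku ukt; rewrite -hp -hq line_le // in st; lra.
  rewrite -hp -hq metric_sym line_le // in st.
  rewrite metric_sym in sku; rewrite metric_sym in ukt.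
  exists (q + d (h q) (k u)).
    by rewrite /= in_itv /= hq ukt; apply/andP; split; lra.
  apply/esym/(@between_line h q p) => //.
  by rewrite hp hq sku ukt; lra.
- apply: continuous_compact; last exact: segment_compact.
  exact/continuous_subspaceT/line_continuous.
Qed.

(** * Points among the convex compact sets *)

Lemma hausdorff_point_leP A x r : A !=set0 -> compact A ->
  hausdorff_dist [set x] A <= r <-> A `<=` cball x r.
Proof.
move=> A0 cA; have [a Aa] := A0.
have x0 : [set x] !=set0 by exists x.
split=> [/(hausdorff_leP _ x0 (@compact_set1 _ x) A0 cA)[_ _]|Ar].
  by rewrite -cball_neighborhood.
apply/(hausdorff_leP _ x0 (@compact_set1 _ x) A0 cA); split.
- exact: le_trans (mdist_ge0 x a) (Ar a Aa).
- by move=> _ ->; exists a => //; rewrite metric_sym; exact: Ar.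
- by rewrite -cball_neighborhood.
Qed.

Lemma hausdorff_point_attained A x : A !=set0 -> compact A ->
  exists2 a, A a & hausdorff_dist [set x] A = d x a.
Proof.
move=> A0 cA; have [a Aa amax] := farthest_point x A0 cA; exists a => //.
apply/eqP; rewrite eq_le; apply/andP; split.
  exact/(hausdorff_point_leP x (d x a) A0 cA).
by have /(hausdorff_point_leP x _ A0 cA) := lexx (hausdorff_dist [set x] A); exact.
Qed.

Lemma hausdorff_points x y : hausdorff_dist [set x] [set y] = d x y.
Proof.
have [||_ -> //] := @hausdorff_point_attained [set y] x; first by exists y.
exact: compact_set1.
Qed.

(** The farthest distance to [A] is a 1-Lipschitz function [f].  For [a0] in [A],
outside the compact ball about [a0] of radius [f a0] the values of [f] exceed
[f a0], so [f] attains its infimum. *)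
Lemma circumcenter A : A !=set0 -> compact A ->
  exists c r, A `<=` cball c r /\ forall x, exists2 a, A a & r <= d x a.
Proof.
move=> A0 cA.
have far x : {a | A a & forall b, A b -> d x b <= d x a}.
  by apply: cid2; exact: farthest_point.
pose f x := d x (s2val (far x)).
have fA x : A (s2val (far x)) by exact: (s2valP (far x)).
have fmax x b : A b -> d x b <= f x by exact: (s2valP' (far x)).
have [a0 Aa0] := A0.
have [x y|||c _ cmin] := @lipschitz1_min _ _ f (cball a0 (f a0)).
- by have := metric_triangle x y (s2val (far x)); have := fmax y _ (fA x); rewrite /f; lra.
- by exists a0; rewrite /cball /= mdistxx mdist_ge0.
- exact: Xproper.
exists c, (f c); split=> [a Aa|x]; first exact: fmax.
exists (s2val (far x)) => //; rewrite -/(f x).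
have [xa0|/ltW xa0] := leP (d a0 x) (f a0); first exact: cmin.
have ca0 : f c <= f a0 by apply: cmin; rewrite /cball /= mdistxx mdist_ge0.
by rewrite (le_trans ca0) // (le_trans xa0) // metric_sym fmax.
Qed.

(** Moving the center by [t] along [h] cannot decrease the radius, so some [y] in
[A] has [d (h t) y >= r].  By convexity [y] stays at distance at least [r] from
the rest of the ray, and it has distance at least [r - t] from its beginning.
Thus the largest distance from a point of [A] to the segment is at least
[r - t] for every [t > 0], and it is attained. *)
Lemma circumcenter_opposite A c r h : A !=set0 -> compact A ->
    A `<=` cball c r -> (forall x, exists2 a, A a & r <= d x a) ->
    line h -> h 0 = c ->
  exists2 a, A a & forall s, 0 <= s <= r -> r <= d (h s) a.
Proof.
move=> A0 cA Acr far lh h0.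
have [a1 Aa1 _] := far c.
have r0 : 0 <= r := le_trans (mdist_ge0 c a1) (Acr a1 Aa1).
have [B0 _ cB] := arc_convex_compact lh r0.
have [a [b [Aa Bb ab AB]]] := excess_attained A0 cA B0 cB.
exists a => // s s0r; rewrite metric_sym.
apply: (le_trans _ (ab (h s) _)); last by exists s => //=; rewrite in_itv.
have [->|/eqP rn0] := eqVneq r 0; first exact: mdist_ge0.
have {rn0}r_gt0 : 0 < r by rewrite lt_neqAle eq_sym r0 andbT; apply/eqP.
apply/ler_addgt0Pl => e e0.
pose t := Num.min e r.
have t0 : 0 < t by rewrite lt_min e0.
have te : t <= e by rewrite ge_min lexx.
have tr : t <= r by rewrite ge_min lexx orbT.
have [y Ay ry] := far (h t).
have [_ [v + <-] yv] := AB y Ay; rewrite /= in_itv /= => /andP[v0 vr].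
suff : r - t <= d (h v) y by rewrite metric_sym; lra.
have [vt|tv] := leP v t.
  have := metric_triangle (h t) (h v) y.
  by rewrite (metric_sym (h t) (h v)) (line_le lh vt); lra.
(* h t is the convex combination of h 0 and h v with weight t / v *)
have [k [lk k0 _]] := line_through y y.
have v_gt0 : 0 < v by lra.
have w0 : 0 < t / v by rewrite divr_gt0.
have w1 : t / v < 1 by rewrite ltr_pdivrMr // mul1r.
have := @line_convex h k 0 v 0 0 (t / v) lh lk.
rewrite (ltW w0) (ltW w1) !add0r divfK ?gt_eqF // mulr0 k0 h0 => /(_ isT).
by have : d c y <= r := Acr y Ay; nra.
Qed.

(** The contraction of ratio 1/2 towards [c] at least halves distances, and it
maps [k (2 * r)] to [a]. *)
Lemma opposite_double c r h k a : line h -> line k -> h 0 = c -> k 0 = c ->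
    k r = a -> (forall s, 0 <= s <= r -> r <= d (h s) a) ->
  forall s, 0 <= s <= 2 * r -> 2 * r <= d (h s) (k (2 * r)).
Proof.
move=> lh lk h0 k0 kr ha s /andP[s0 sr].
have := @line_convex h k 0 s 0 (2 * r) 2^-1 lh lk.
have half01 : 0 <= (2^-1 : R) <= 1 by lra.
rewrite half01.
have -> : 0 + 2^-1 * (2 * r) = r by lra.
rewrite !add0r h0 k0 kr mdistxx => /(_ isT).
by have := ha (2^-1 * s); lra.
Qed.

Local Notation CX := (set_type (convex_compacts X)).
Local Notation dH := (@hausdorff_metric R X).

(** Four sets near [C] that are pairwise as far apart as the triangle inequality
allows; a notion that surjective isometries of the metric [dH] preserve. *)
Definition four_spread (C : CX) := exists r (F : nat -> CX),
  [/\ 0 < r, forall i, (i < 4)%N -> dH C (F i) <= r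
    & forall i j, (i < j < 4)%N -> 2 * r <= dH (F i) (F j)].

Definition is_point (C : CX) := exists x, sval C = [set x].

Lemma CXP (C : CX) : convex_compacts X (sval C).
Proof. exact/set_mem/(svalP C). Qed.

Definition toCX A (hA : convex_compacts X A) : CX := exist _ A (mem_set hA).

Definition point x : CX := toCX (set1_convex_compact x).

(** The inequalities force [x] to be the midpoint of [a] and [b], and of [a] and
[b'], so both points prolong the geodesic from [a] to [x] by [r]. *)
Lemma antipode_unique x r a b b' : 0 < r ->
    d x a <= r -> d x b <= r -> d x b' <= r -> 2 * r <= d a b ->
    2 * r <= d a b' -> b = b'.
Proof.
move=> r0 xa xb xb' ab ab'.
have := metric_triangle a x b; have := metric_triangle a x b'.
rewrite (metric_sym a x) => t t'.
have ax : a <> x by move=> ax; rewrite ax in ab; lra.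
by apply: (extension_unique ax); rewrite ?(metric_sym a x); lra.
Qed.

(** An element of one set that is [2 r] away from the other set is antipodal to all
elements of the latter. *)
Lemma spread_pair (C D : CX) x r : 0 < r ->
    dH (point x) C <= r -> dH (point x) D <= r -> 2 * r <= dH C D ->
  is_point C \/ is_point D.
Proof.
move=> r0; have [C0 _ cC] := CXP C; have [D0 _ cD] := CXP D.
move=> /(hausdorff_point_leP _ _ C0 cC) Cr /(hausdorff_point_leP _ _ D0 cD) Dr.
have one A B a : B !=set0 -> A `<=` cball x r -> B `<=` cball x r -> A a ->
    (forall b, B b -> 2 * r <= d a b) -> exists y, B = [set y].
  move=> [b Bb] Ar Br Aa aB; exists b.
  apply/seteqP; split => [b' Bb'|_ -> //]; apply: (@antipode_unique x r a) => //.
  - exact: Ar.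
  - exact: Br.
  - exact: Br.
  - exact: aB.
  - exact: aB.
have r20 : 0 < 2 * r by lra.
move=> /(hausdorff_geP C0 cC D0 cD r20)[[a Ca aD]|[b Db bC]].
  by right; apply: (one (sval C) _ a).
by left; apply: (one (sval D) _ b).
Qed.

(** Of any two of the four sets one is a singleton, so three of them are, and the
second and the third are both the antipode of the first. *)
Lemma point_not_spread x : ~ four_spread (point x).
Proof.
move=> [r [F [r0 Fr Fij]]].
have pair i j : (i < j < 4)%N -> is_point (F i) \/ is_point (F j).
  move=> ij; have /andP[lt_ij j4] := ij.
  by apply: (spread_pair r0 (Fr i _) (Fr j j4)); [exact: ltn_trans j4|exact: Fij].
have three i j l : (i < j < l)%N -> (l < 4)%N ->
    is_point (F i) -> is_point (F j) -> is_point (F l) -> False.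
  move=> /andP[ij jl] l4 [y1 y1E] [y2 y2E] [y3 y3E].
  have j4 := ltn_trans jl l4; have i4 := ltn_trans ij j4.
  have := Fr i i4; have := Fr j j4; have := Fr l l4.
  have := @Fij i j; have := @Fij i l; have := @Fij j l.
  rewrite ij jl j4 l4 (ltn_trans ij jl) => /(_ isT) + /(_ isT) + /(_ isT).
  rewrite /hausdorff_metric y1E y2E y3E /= !hausdorff_points.
  move=> y23 y13 y12 xy3 xy2 xy1.
  have y2y3 : y2 = y3 by apply: (@antipode_unique x r y1).
  by rewrite y2y3 mdistxx in y23; lra.
have [p0|n0] := pselect (is_point (F 0)); last first.
  have [//|p1] := pair 0 1 isT; have [//|p2] := pair 0 2 isT.
  by have [//|p3] := pair 0 3 isT; exact: (three 1 2 3).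
have [p1|n1] := pselect (is_point (F 1)); last first.
  have [//|p2] := pair 1 2 isT; have [//|p3] := pair 1 3 isT.
  exact: (three 0 2 3).
have [p2|n2] := pselect (is_point (F 2)); first exact: (three 0 1 2).
by have [//|p3] := pair 2 3 isT; exact: (three 0 1 3).
Qed.

(** The four sets are [W = {c}] for a circumcenter [c], the segments [Q] and [S]
of length [2 r] that prolong two radii, and the neighborhood [P].  The radius
in [S] is chosen opposite to the ray of [Q], and a third radius, whose double
ends in [P], opposite to the ray of [S]. *)
Lemma not_point_spread (C : CX) : ~ is_point C -> four_spread C.
Proof.
move=> nC; have hC := CXP C; have [C0 _ cC] := hC.
have [c [r [Cr far]]] := circumcenter C0 cC.
have [a0 Ca0] := C0.
have r_ge0 : 0 <= r := le_trans (mdist_ge0 c a0) (Cr a0 Ca0).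
have r0 : 0 < r.
  rewrite lt_neqAle r_ge0 andbT eq_sym; apply/eqP => r0; apply: nC; exists c.
  have eq_c a : sval C a -> a = c.
    move=> Ca; apply/esym/mdist_positivity/eqP; rewrite eq_le mdist_ge0 andbT.
    by rewrite -r0; exact: Cr.
  by apply/seteqP; split=> [a /eq_c -> //|_ ->]; rewrite -(eq_c a0).
have ray a : sval C a -> r <= d c a -> exists k, [/\ line k, k 0 = c & k r = a].
  move=> Ca ra; have [k [lk k0 ka]] := line_through c a; exists k; split=> //.
  by have -> : r = d c a by apply/eqP; rewrite eq_le ra; exact: Cr.
have opp h : line h -> h 0 = c -> exists k, [/\ line k, k 0 = c, sval C (k r)
    & forall s, 0 <= s <= 2 * r -> 2 * r <= d (h s) (k (2 * r))].
  move=> lh h0; have [a Ca ha] := circumcenter_opposite C0 cC Cr far lh h0.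
  have [|k [lk k0 kr]] := ray a Ca; first by rewrite -h0 ha // lexx.
  by exists k; split => //; [rewrite kr|exact: (opposite_double lh lk h0 k0 kr ha)].
have [y Cy /(ray y Cy)[h1 [lh1 h10 h1r]]] := far c.
have [h2 [lh2 h20 Ch2 h12]] := opp h1 lh1 h10.
have [h3 [lh3 h30 Ch3 h23]] := opp h2 lh2 h20.
have Ch1 : sval C (h1 r) by rewrite h1r.
have r2 : 0 <= 2 * r by lra.
have arc_end h : arc h (2 * r) (h (2 * r)).
  by exists (2 * r) => //=; rewrite in_itv /= r2 lexx.
have arc_c h : h 0 = c -> arc h (2 * r) c.
  by move=> <-; exists 0 => //=; rewrite in_itv /= r2 lexx.
have nbh_end h : line h -> sval C (h r) ->
    closed_neighborhood r (sval C) (h (2 * r)).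
  by move=> lh Ch; exists (h r) => //; rewrite line_le //; lra.
pose W := point c.
pose Q := toCX (arc_convex_compact lh1 r2).
pose S := toCX (arc_convex_compact lh2 r2).
pose P := toCX (neighborhood_convex_compact r_ge0 hC).
exists r, (nth P [:: W; Q; S]).
have arc_close h (lh : line h) : h 0 = c -> sval C (h r) ->
    dH C (toCX (arc_convex_compact lh r2)) <= r.
  move=> h0 Ch; have [B0 _ cB] := arc_convex_compact lh r2.
  apply/(hausdorff_leP _ C0 cC B0 cB); split=> // [a Ca|_ [s + <-]].
    by exists c; [exact: arc_c|exact: Cr].
  rewrite /= in_itv /= => /andP[s0 s2]; exists (h r) => //.
  by rewrite lh ler_norml; lra.
have far_ge (A B : CX) x : sval A x -> (forall b, sval B b -> 2 * r <= d b x) ->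
    2 * r <= dH B A.
  have [A0 _ cA] := CXP A; have [B0 _ cB] := CXP B => Ax xB.
  rewrite /hausdorff_metric hausdorff_sym.
  by apply: (hausdorff_ge A0 cA B0 cB Ax) => b Bb; rewrite metric_sym; exact: xB.
have far_c h : line h -> h 0 = c -> forall b, sval W b -> 2 * r <= d b (h (2 * r)).
  by move=> lh h0 _ ->; rewrite -h0 line_le //; lra.
have far_arc h (lh : line h) z : (forall s, 0 <= s <= 2 * r -> 2 * r <= d (h s) z) ->
    forall b, sval (toCX (arc_convex_compact lh r2)) b -> 2 * r <= d b z.
  by move=> hz _ [s + <-]; rewrite /= in_itv; exact: hz.
split=> // [[|[|[|[|]]]] //= _|i j /andP[ij j4]].
- by rewrite /hausdorff_metric hausdorff_sym; exact/hausdorff_point_leP.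
- exact: arc_close.
- exact: arc_close.
- have [P0 _ cP] := neighborhood_convex_compact r_ge0 hC.
  apply/(hausdorff_leP _ C0 cC P0 cP); split=> // a Ca.
  by exists a; [exists a|]; rewrite ?mdistxx.
case: j ij j4 => [|[|[|[|j]]]] // ij _; case: i ij => [|[|[|i]]] //= _.
- exact: (far_ge Q W _ (arc_end h1) (far_c h1 lh1 h10)).
- exact: (far_ge S W _ (arc_end h2) (far_c h2 lh2 h20)).
- exact: (far_ge S Q _ (arc_end h2) (far_arc h1 lh1 _ h12)).
- exact: (far_ge P W _ (nbh_end h1 lh1 Ch1) (far_c h1 lh1 h10)).
- exact: (far_ge P Q _ (nbh_end h2 lh2 Ch2) (far_arc h1 lh1 _ h12)).
- exact: (far_ge P S _ (nbh_end h3 lh3 Ch3) (far_arc h2 lh2 _ h23)).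
Qed.
Lemma CX_inj (C D : CX) : sval C = sval D -> C = D.
Proof. exact: val_inj. Qed.

(** * Recovering a set from its distances to balls *)

Definition cballCX x r (r0 : 0 <= r) : CX := toCX (cball_convex_compact x r0).

(** Suppose [p] is not in [C], let [q] be its nearest point in [C], and let [w] be
the point at distance [r] behind [p] on the ray from [q].  An element [c] of [C]
with [d c w <= r] would give, by contraction towards [q], an element of [C]
strictly closer to [p] than [q]. *)
Lemma mem_cball_hausdorff (C : CX) p :
  sval C p <-> exists r (r0 : 0 <= r), dH C (cballCX p r0) <= r.
Proof.
have [C0 vC cC] := CXP C; split=> [Cp|[r [r0]]].
  have [a _ amax] := farthest_point p C0 cC.
  have r0 := mdist_ge0 p a; exists (d p a), r0.
  have [B0 _ cB] := cball_convex_compact p r0.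
  apply/(hausdorff_leP _ C0 cC B0 cB); split=> // [b Cb|b pb].
    by exists p; [rewrite /= /cball /= mdistxx|exact: amax].
  by exists p.
have [B0 _ cB] := cball_convex_compact p r0.
move=> /(hausdorff_leP _ C0 cC B0 cB)[_ _ BC].
have [q Cq qmin] := nearest_point p C0 cC.
have [->|/eqP qp] := eqVneq p q; first exact: Cq.
exfalso.
have qp0 : 0 < d q p by rewrite mdist_gt0 eq_sym; apply/eqP.
have [h [lh h0 hp]] := line_through q p.
have [|c Cc cw] := BC (h (d q p + r)).
  by rewrite /= /cball /= -[X in d X]hp line_le //; lra.
have [k [lk k0 kc]] := line_through q c.
(* the ratio of the contraction centered at q that maps w to p *)
pose u := d q p / (d q p + r).
have u0 : 0 < u by rewrite divr_gt0 //; lra.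
have u1 : u <= 1 by rewrite ler_pdivrMr ?mul1r; lra.
have uE : u * (d q p + r) = d q p by rewrite divfK // gt_eqF //; lra.
have Ck : sval C (k (u * d q c)).
  apply: ((convex_lineP _).1 vC k 0 _ (d q c)) => //.
  - by have := mdist_ge0 q c; nra.
  - by rewrite k0.
  - by rewrite kc.
have := @line_convex h k 0 (d q p + r) 0 (d q c) u lh lk.
rewrite (ltW u0) u1 !add0r uE hp h0 k0 kc mdistxx => /(_ isT).
have := qmin _ Ck; rewrite (metric_sym p q) => qk.
rewrite metric_sym in cw; have := mulr_gt0 u0 qp0; nra.
Qed.

(** * The isometry induced on the space *)

Context (I : CX -> CX) (Iiso : isometry_onto dH I).

Lemma spread_isometry (C : CX) : four_spread (I C) <-> four_spread C.
Proof.
have [Id Isurj] := Iiso; split=> -[r [F [r0 Fr Fij]]].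
  have [G GF] := choice (fun n => Isurj (F n)).
  exists r, G; split=> // [n n4|m n mn]; rewrite -Id !GF; first exact: Fr.
  exact: Fij.
exists r, (I \o F); split=> // [n n4|m n mn] /=; rewrite Id; first exact: Fr.
exact: Fij.
Qed.

Lemma isometry_is_point (C : CX) : is_point (I C) <-> is_point C.
Proof.
have spreadP D : four_spread D <-> ~ is_point D.
  split; last exact: not_point_spread.
  move=> sD [x DE]; apply: (@point_not_spread x).
  by have <- : D = point x by exact: CX_inj.
split=> pC; apply: contrapT => /spreadP.
  by move=> /spread_isometry/spreadP.
by move=> /spread_isometry/spreadP.
Qed.

Lemma induced_isometry : exists2 i : X -> X,
  isometry_onto d i & forall x, I (point x) = point (i x).
Proof.
have [Id Isurj] := Iiso.
have pt x : exists y, I (point x) = point y.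
  have [|y yE] := (isometry_is_point (point x)).2; first by exists x.
  by exists y; exact: CX_inj.
have [i iE] := choice pt.
exists i => //; split=> [x y|y].
  have := Id (point x) (point y).
  by rewrite !iE /hausdorff_metric /= !hausdorff_points.
have [C CE] := Isurj (point y).
have [x xE] : is_point C by apply/isometry_is_point; rewrite CE; exists y.
exists x; have : I (point x) = point y by rewrite -CE; congr I; exact/CX_inj/esym.
rewrite iE => /(congr1 sval) /= e.
by have : [set y] (i x) by rewrite -e.
Qed.

(** With [z = h (-1)] at distance 1 behind [x], the ball [B(x, r)] has its farthest
distance [r + 1] from [z] at [p'].  Its image lies in [B(i x, r)] and has a
point [b] at distance [r + 1] from [i z]; then [i z], [i x], [b] are aligned,
just as [i z], [i x], [i p'], and so [b = i p']. *)
Lemma isometry_cball i : isometry_onto d i -> (forall x, I (point x) = point (i x)) ->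
  forall x r (r0 : 0 <= r), I (cballCX x r0) = cballCX (i x) r0.
Proof.
move=> [id isurj] iE x r r0; have [Id _] := Iiso.
set B := cballCX x r0; have [B0 _ cB] := CXP B.
have [B'0 vB' cB'] := CXP (I B).
have dB y : hausdorff_dist [set i y] (sval (I B)) = hausdorff_dist [set y] (sval B).
  by have := Id (point y) B; rewrite iE.
have B'r : sval (I B) `<=` cball (i x) r.
  by apply/(hausdorff_point_leP _ _ B'0 cB'); rewrite dB; exact/hausdorff_point_leP.
have sphere p : d (i x) p = r -> sval (I B) p.
  have [p' <- xp] := isurj p; rewrite id in xp.
  have [h [lh h0 hp]] := line_through x p'.
  have r1 : 0 <= r + 1 by lra.
  have xz : d (h (-1)) x = 1 by rewrite -[X in d _ X]h0 line_le //; lra.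
  have zp : d (h (-1)) p' = r + 1 by rewrite -[X in d _ X]hp line_le //; lra.
  have [b Bb zb] := hausdorff_point_attained (i (h (-1))) B'0 cB'.
  have rzb : r + 1 <= d (i (h (-1))) b.
    rewrite -zb dB -zp.
    have /(hausdorff_point_leP _ _ B0 cB) := lexx (hausdorff_dist [set h (-1)] (sval B)).
    by apply; rewrite /= /cball /= xp.
  have xb := B'r b Bb; rewrite /cball /= in xb.
  have := metric_triangle (i (h (-1))) (i x) b; rewrite id xz => tri.
  have zx : i (h (-1)) <> i x.
    by move=> /(congr1 (d (i x))); rewrite !id mdistxx metric_sym xz; lra.
  have <- // : b = i p'.
  by apply: (extension_unique zx); rewrite !id ?xz ?zp ?xp; lra.
apply: CX_inj; apply/seteqP; split=> // p xp; rewrite /= /cball /= in xp.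
have [h [lh h0 hp]] := line_through (i x) p.
rewrite -hp; apply: ((convex_lineP _).1 vB' h (- r) _ r) => //.
- by have := mdist_ge0 (i x) p; lra.
- by apply: sphere; rewrite -h0 lh sub0r opprK ger0_norm.
- by apply: sphere; rewrite -h0 lh sub0r normrN ger0_norm.
Qed.

End Lines.

Theorem theorem1 (R : realType) (X : metricType R)
    (Xproper : proper_space X)
    (Xuniq : uniquely_geodesic X)
    (Xcomplete : geodesically_complete X)
    (Xnosplit : geodesics_do_not_split X)
    (Xmid : midpoint_convex X)
    (I : set_type (convex_compacts X) -> set_type (convex_compacts X))
    (Iiso : isometry_onto (@hausdorff_metric R X) I) :
  exists i : X -> X,
    isometry_onto (@mdist R X) i /\
    forall C : set_type (convex_compacts X), sval (I C) = i @` sval C.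
Proof.
have [i iiso iE] := induced_isometry Xuniq Xcomplete Xnosplit Xmid Xproper Iiso.
exists i; split=> // C.
have memP D := mem_cball_hausdorff Xuniq Xcomplete Xmid Xproper D.
have memi p : sval (I C) (i p) <-> sval C p.
  split=> /memP [r [r0 rC]]; apply/memP; exists r, r0; move: rC;
    by rewrite -(isometry_cball Xnosplit Xmid Xproper Iiso iiso iE) Iiso.1.
apply/seteqP; split=> [y|_ [p Cp <-]]; last exact/memi.
by have [p <-] := iiso.2 y; move/memi => Cp; exists p.
Qed.
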